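(* Let $r,s\ge 0$ be integers and $n=r+2s$. Let $\mathbb{R}^n$ be equipped with a quadratic form of signature $(r+s,s)$, with associated symmetric bilinear form $\langle\cdot,\cdot\rangle$. Let $f:\mathbb{R}^n\to\mathbb{R}^n$ be a linear endomorphism that is self-adjoint with respect to $\langle\cdot,\cdot\rangle$, i.e. $\langle f(X),Y\rangle=\langle X,f(Y)\rangle$ for all $X,Y\in\mathbb{R}^n$. Then $f$ has at least $r$ real eigenvalues counted with multiplicity (as roots of the characteristic polynomial of $f$).
   Context: A quadratic form of signature $(r+s,s)$ on $\mathbb{R}^{r+2s}$ is a nondegenerate quadratic form which, in a suitable basis, is given by the matrix $\mathrm{Id}_{r+s}\oplus(-\mathrm{Id}_s)$ (block diagonal direct sum of identity matrices with signs). *)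

(* Defs.v *)
From HB Require Import structures.
From mathcomp Require Import all_boot all_order all_algebra.
From mathcomp Require Import polyrcf.
From mathcomp Require Import reals.

Set Implicit Arguments.
Unset Strict Implicit.
Unset Printing Implicit Defensive.

Import Order.TTheory GRing.Theory Num.Theory.

Local Open Scope ring_scope.

Definition signature_mx (R : realType) (p q : nat) : 'M[R]_(p + q) :=
  block_mx 1%:M 0 0 (- 1%:M).

(* The size of the basis b forces
   dim V = p + q, and Q is nondegenerate since signature_mx is invertible. *)
Definition has_signature (R : realType) (V : vectType R) (Q : V -> R)
    (p q : nat) : Prop :=
  exists2 b : (p + q).-tuple V, basis_of fullv b &
    forall x : 'rV[R]_(p + q),
      Q (\sum_(i < p + q) x 0 i *: tnth b i)
        = (x *m signature_mx R p q *m x^T) 0 0.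

(* lin1_mx f is the matrix of f acting on row vectors, in the standard basis. *)
Definition charpoly_of (R : realType) (n : nat)
    (f : {linear 'rV[R]_n -> 'rV[R]_n}) : {poly R} :=
  char_poly (lin1_mx f).

(* rootsR p lists each real root of p (here p != 0) exactly once. *)
Definition num_real_eigenvalues (R : realType) (n : nat)
    (f : {linear 'rV[R]_n -> 'rV[R]_n}) : nat :=
  (\sum_(a <- rootsR (charpoly_of f)) mup a (charpoly_of f))%N.

(* Main.v *)
Require Import Defs.
From mathcomp Require Import all_boot all_order all_algebra.
From mathcomp Require Import polyrcf complex.
From mathcomp Require Import reals.

Set Implicit Arguments.
Unset Strict Implicit.
Unset Printing Implicit Defensive.

Import Order.TTheory GRing.Theory Num.Theory.

Local Open Scope ring_scope.

(** Let G be the Gram matrix of the form and A the matrix of f, both acting on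
    row vectors; self-adjointness reads A G = G A^T.  Over R[i], extend the form
    to the Hermitian form h(x, y) = x G y^*.  Generalized eigenspaces of A for
    eigenvalues z and z' are h-orthogonal unless z is the conjugate of z', so the
    sum of the generalized eigenspaces with eigenvalues in the open upper half
    plane is totally isotropic for h.  Its dimension is the number m of such
    eigenvalues counted with multiplicity.  A totally isotropic subspace meets a
    positive definite one only in 0, and h is positive definite on a subspace of
    dimension r + s; hence m + (r + s) <= n, that is m <= s.  The same holds for
    the lower half plane, so at most 2 s of the n complex eigenvalues are not
    real, and at least r are.

    To avoid generalized eigenspaces, [invariant_flag] attaches to any list l of
    roots of the characteristic polynomial (with multiplicity) an invariant
    subspace of dimension [size l] on which the endomorphism is triangular with
    diagonal l.  Isotropy then amounts to the uniqueness of the solution of a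
    triangular Sylvester equation ([sylvester_trig_eq0],
    [invariant_flag_isotropic]).  The dimension count is [nonreal_root_bound];
    [bound_real_roots] combines it for the two half planes, using the
    factorization [real_factor_split] that isolates the nonreal roots. *)

(** * Invariant subspaces with prescribed eigenvalues *)

Lemma char_poly_conj (F : fieldType) n (P M N : 'M[F]_n) :
  P \in unitmx -> P *m M = N *m P -> char_poly N = char_poly M.
Proof.
move=> uP PM; pose P' := map_mx polyC P.
have detP' : \det P' != 0.
  by rewrite det_map_mx polyC_eq0 -unitfE -unitmxE.
have E : P' *m char_poly_mx M = char_poly_mx N *m P'.
  rewrite /char_poly_mx mulmxBr mulmxBl -!map_mxM PM.
  by rewrite scalar_mxC.
by apply: (mulfI detP'); rewrite /char_poly mulrC -!det_mulmx E.
Qed.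

Lemma char_poly_lblock (F : fieldType) m n (A : 'M[F]_m) (B : 'M[F]_(n, m))
    (D : 'M[F]_n) :
  char_poly (block_mx A 0 B D) = char_poly A * char_poly D.
Proof.
rewrite /char_poly /char_poly_mx map_block_mx scalar_mx_block opp_block_mx.
by rewrite add_block_mx map_mx0 subr0 det_lblock.
Qed.

(** The extended row basis of an eigenvector v is an invertible matrix whose
    first row is a nonzero multiple of v, hence again an eigenvector. *)
Lemma eigenvalue_lblock (F : fieldType) n (M : 'M[F]_(1 + n)) (z : F) :
  root (char_poly M) z ->
  exists P c M', P \in unitmx /\ P *m M = block_mx z%:M 0 c M' *m P.
Proof.
rewrite -eigenvalue_root_char => /eigenvalueP [v vM v0].
pose P := row_ebase v; pose N := P *m M *m invmx P.
have uP : P \in unitmx := row_ebase_unit v.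
have PM : P *m M = N *m P by rewrite /N mulmxKV.
have rv : \rank v = 1%N by apply/eqP; rewrite rank_rV v0.
have e0 : pid_mx (\rank v) = row_mx 1%:M 0 :> 'M[F]_(1, 1 + n).
  by rewrite rv pid_mx_row.
have eP : row_mx 1%:M 0 *m P *m M = z *: (row_mx 1%:M 0 *m P).
  have vE : v = col_ebase v *m (row_mx 1%:M 0 *m P).
    by rewrite -e0 mulmxA mulmx_ebase.
  have := vM; rewrite {1 2}vE scalemxAr -!mulmxA.
  move/(congr1 (mulmx (invmx (col_ebase v)))).
  by rewrite !mulKmx ?col_ebase_unit.
have eN : row_mx 1%:M 0 *m N = row_mx z%:M 0.
  rewrite /N !mulmxA eP -scalemxAl mulmxK // scale_row_mx scaler0.
  by rewrite scale_scalar_mx mulr1.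
exists P, (dlsubmx N), (drsubmx N); split=> //; rewrite PM -{1}(submxK N).
move: eN; rewrite -{1}(submxK N) mul_row_block !mul1mx !mul0mx !addr0.
by case/eq_row_mx => -> ->.
Qed.

(** Induction on l: split off an eigenvector for the head z of l as in
    [eigenvalue_lblock].  The quotient block M' has the remaining
    characteristic polynomial, hence an invariant W for the tail of l; its
    preimage, which contains the eigenvector, is the required subspace.  The
    first row of P spans the eigenline, so the new subspace has the block
    basis diag(1, W) in the coordinates P. *)
Lemma invariant_flag (F : fieldType) (l : seq F) n (M : 'M[F]_n) (g : {poly F}) :
  char_poly M = \prod_(z <- l) ('X - z%:P) * g ->
  exists (W : 'M[F]_(size l, n)) (T : 'M[F]_(size l)),
    [/\ row_free W, W *m M = T *m W, is_trig_mx T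
      & forall i, T i i = l`_i].
Proof.
elim: l n M g => [|z l IH] n M g.
  move=> _; exists 0, 0; split; first by rewrite /row_free mxrank0.
  - by apply/matrixP; case.
  - by apply/is_trig_mxP; case.
  by case.
case: n M => [|n] M.
  move=> cM; have : root (char_poly M) z.
    by rewrite cM big_cons -mulrA rootM root_XsubC eqxx.
  by rewrite /char_poly det_mx00 (negPf (root1 z)).
rewrite big_cons -mulrA => cM.
have [|P [c [M' [uP PM]]]] := @eigenvalue_lblock F n M z.
  by rewrite cM rootM root_XsubC eqxx.
have [|W [T [/row_freeP [W' WW'] WM Ttrig Td]]] := IH n M' g.
  have := char_poly_conj uP PM; rewrite cM char_poly_lblock.
  have -> : char_poly (z%:M : 'M[F]_1) = 'X - z%:P.
    by rewrite /char_poly det_mx11 !mxE eqxx.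
  by apply: mulfI; rewrite polyXsubC_eq0.
suff: exists (W1 : 'M[F]_(1 + size l, 1 + n)) (T1 : 'M[F]_(1 + size l)),
    [/\ row_free W1, W1 *m M = T1 *m W1, is_trig_mx T1
      & forall i, T1 i i = (z :: l)`_i] by [].
exists (block_mx 1%:M 0 0 W *m P), (block_mx z%:M 0 (W *m c) T); split.
- apply/row_freeP; exists (invmx P *m block_mx 1%:M 0 0 W').
  rewrite mulmxA mulmxK // mulmx_block !mulmx0 !mul0mx !addr0 !add0r.
  by rewrite mulmx1 WW' -scalar_mx_block.
- rewrite -mulmxA PM !mulmxA; congr (_ *m P); rewrite !mulmx_block.
  by rewrite !mulmx0 !mul0mx !mul1mx !mulmx1 !addr0 !add0r WM.
- by rewrite is_trig_block_mx // eqxx Ttrig andbT /= scalar_mx_is_trig.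
move=> i; case: (unliftP ord0 i) => [j|] ->.
  have -> : lift ord0 j = rshift 1 j by apply: val_inj.
  by rewrite block_mxEdr Td.
have -> : ord0 = lshift (size l) (ord0 : 'I_1) by apply: val_inj.
by rewrite block_mxEul mxE eqxx.
Qed.

(** * Isotropy of invariant subspaces *)

(** Compare the entries (i, j): triangularity leaves only
    (T i i - S j j) * H i j and terms in entries of H with a smaller index sum,
    which vanish by induction. *)
Lemma sylvester_trig_eq0 (F : fieldType) m (T S H : 'M[F]_m) :
  is_trig_mx T -> is_trig_mx S -> (forall i j, T i i != S j j) ->
  T *m H = H *m S^T -> H = 0.
Proof.
move=> /is_trig_mxP tT /is_trig_mxP tS TS TH; apply/matrixP => i j.
rewrite [RHS]mxE; have [k] := ubnP (i + j); elim: k i j => // k IH i j; rewrite ltnS => lk.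
have := congr1 (fun A : 'M_m => A i j) TH; rewrite !mxE.
rewrite (bigD1 i) //= [X in _ + X]big1; last first.
  move=> a ai; case: (ltngtP a i) => [lt|lt|/val_inj e].
  - by rewrite IH ?mulr0 //; apply: leq_trans lk; rewrite ltn_add2r.
  - by rewrite tT ?mul0r.
  - by rewrite e eqxx in ai.
rewrite [RHS](bigD1 j) //= [X in _ = _ + X]big1; last first.
  move=> a aj; rewrite mxE; case: (ltngtP a j) => [lt|lt|/val_inj e].
  - by rewrite IH ?mul0r //; apply: leq_trans lk; rewrite ltn_add2l.
  - by rewrite tS ?mulr0.
  - by rewrite e eqxx in aj.
rewrite !addr0 mxE mulrC => /eqP; rewrite -subr_eq0 -mulrBr mulf_eq0.
by rewrite subr_eq0 (negPf (TS i j)) orbF => /eqP.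
Qed.

(** The matrix H = W G W^* of the form on the row space of W satisfies
    T H = H T^*, because T W = W M and M is self-adjoint. *)
Lemma invariant_flag_isotropic (F : fieldType) (theta : {rmorphism F -> F})
    m n (M G : 'M[F]_n) (W : 'M[F]_(m, n)) (T : 'M[F]_m) :
  M *m G = G *m (map_mx theta M)^T -> W *m M = T *m W ->
  is_trig_mx T -> (forall i j, T i i != theta (T j j)) ->
  W *m G *m (map_mx theta W)^T = 0.
Proof.
move=> MG WM tT TT; apply: (@sylvester_trig_eq0 _ _ T (map_mx theta T)) => //.
- apply/is_trig_mxP => i j ij; rewrite mxE.
  by move/is_trig_mxP: tT => -> //; rewrite rmorph0.
- by move=> i j; rewrite mxE.
rewrite -[RHS]mulmxA -trmx_mul -map_mxM -WM map_mxM trmx_mul.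
by rewrite !mulmxA -WM -(mulmxA W M) MG !mulmxA.
Qed.

(** * Bounding the number of nonreal eigenvalues *)

Lemma conjc_form_definite (R : rcfType) n (c : 'rV[R[i]]_n) :
  c *m (map_mx (@conjc R) c)^T = 0 -> c = 0.
Proof.
move=> /matrixP /(_ 0 0); rewrite !mxE => E; apply/rowP => j; rewrite mxE.
have := psumr_eq0P _ E; move=> /(_ _ j isT) H.
have /eqP := H (fun k _ => ltac:(by rewrite !mxE mulcJ_ge0)).
by rewrite !mxE mulf_eq0 conjc_eq0 orbb => /eqP.
Qed.

(** The hypothesis on U says that its p rows are orthonormal, so the form is
    positive definite on their span.  The invariant subspace W attached to l is
    isotropic, hence the rows of U and W together are linearly independent. *)
Lemma nonreal_root_bound (R : rcfType) n p (A G : 'M[R]_n) (U : 'M[R]_(p, n))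
    (l : seq R[i]) (g : {poly R[i]}) :
  A *m G = G *m A^T -> U *m G *m U^T = 1%:M ->
  char_poly (map_mx (real_complex R) A) = \prod_(z <- l) ('X - z%:P) * g ->
  {in l &, forall x y, x != conjc y} ->
  (p + size l <= n)%N.
Proof.
move=> AG UGU cA lP; have [W [T [fW WA tT Td]]] := invariant_flag cA.
set AC := map_mx _ A in cA WA; pose GC := map_mx (real_complex R) G.
pose UC := map_mx (real_complex R) U.
have conjR m1 m2 (X : 'M[R]_(m1, m2)) :
    map_mx (@conjc R) (map_mx (real_complex R) X) = map_mx (real_complex R) X.
  by apply/matrixP => i j; rewrite !mxE conjc_real.
have AGC : AC *m GC = GC *m (map_mx (@conjc R) AC)^T.
  by rewrite conjR map_trmx -!map_mxM AG.
have UGUC : UC *m GC *m (map_mx (@conjc R) UC)^T = 1%:M.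
  by rewrite conjR map_trmx -!map_mxM UGU map_mx1.
have iso : W *m GC *m (map_mx (@conjc R) W)^T = 0.
  apply: (invariant_flag_isotropic AGC WA tT) => i j.
  by rewrite !Td lP ?mem_nth.
suff : row_free (col_mx UC W) by move/eqP <-; exact: rank_leq_col.
rewrite -kermx_eq0; apply/rowV0P => v /sub_kermxP.
rewrite -(hsubmxK v) mul_row_col; set c := lsubmx v; set a := rsubmx v.
move=> /eqP; rewrite addr_eq0 -mulNmx => /eqP cUaW.
(* c U = - a W lies in both subspaces: its Hermitian square is the standard one
   of c by UGUC, and 0 by isotropy. *)
have c0 : c = 0.
  apply: conjc_form_definite.
  have : (c *m UC) *m GC *m (map_mx (@conjc R) (c *m UC))^T = 0.
    rewrite cUaW map_mxM trmx_mul !mulmxA -(mulmxA _ W) -(mulmxA _ (W *m GC)).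
    by rewrite iso mulmx0 mul0mx.
  rewrite map_mxM trmx_mul !mulmxA -(mulmxA _ UC) -(mulmxA _ (UC *m GC)).
  by rewrite UGUC mulmx1.
have : - a *m W = 0 *m W by rewrite -cUaW c0 !mul0mx.
move/(row_free_inj fW)/eqP; rewrite oppr_eq0 => /eqP ->.
by rewrite c0 row_mx0.
Qed.

(** * Real and nonreal roots of a real polynomial *)

Lemma split_roots (F : fieldType) (s : seq F) (p : {poly F}) :
  p != 0 -> uniq s ->
  exists2 g, p = (\prod_(a <- s) ('X - a%:P) ^+ mup a p) * g
    & {in s, forall a, ~~ root g a}.
Proof.
elim: s p => [|a s IH] p p0 /=; first by exists p; rewrite ?big_nil ?mul1r.
case/andP => aNs us; have [k [q aNq pE]] := multiplicity_XsubC p a.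
have {}aNq : ~~ root q a by rewrite p0 in aNq.
have q0 : q != 0 by apply: contraNneq aNq => ->; rewrite root0.
have [g qE gP] := IH q q0 us.
have mupa : mup a p = k by rewrite pE mupMr // mup_XsubCX eqxx.
have mups b : b \in s -> mup b p = mup b q.
  move=> bs; rewrite pE mupMl // rootE horner_exp hornerXsubC expf_neq0 //.
  by rewrite subr_eq0; apply: contraNneq aNs => <-.
exists g.
  rewrite big_cons mupa (eq_big_seq (fun b => ('X - b%:P) ^+ mup b q)).
    by rewrite -mulrA -qE mulrC.
  by move=> b /mups ->.
move=> b; rewrite inE => /predU1P [->|/gP //].
by apply: contra aNq; rewrite {1}qE rootM orbC => ->.
Qed.

(** Remove all real linear factors from p: the cofactor g has no real root, so l,
    the list of the complex roots of g, has no real element. *)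
Lemma real_factor_split (R : rcfType) (p : {poly R}) : p \is monic ->
  exists l : seq R[i],
    [/\ (size p = (\sum_(a <- rootsR p) mup a p + size l).+1)%N,
       {in l, forall z, complex.Im z != 0}
     & exists h, map_poly (real_complex R) p = \prod_(z <- l) ('X - z%:P) * h].
Proof.
move=> pM; have p0 := monic_neq0 pM.
have [g pE gP] := split_roots p0 (uniq_roots _ _ _ : uniq (rootsR p)).
set h := \prod_(a <- _) _ in pE.
have hM : h \is monic by apply: monic_prod => a _; rewrite monic_exp ?monicXsubC.
have gM : g \is monic by rewrite -(monicMl _ hM) -pE.
have [l lE] := closed_field_poly_normal (map_poly (real_complex R) g).
have gcM : map_poly (real_complex R) g \is monic by rewrite map_monic.
rewrite (monicP gcM) scale1r in lE.
have sg : size g = (size l).+1.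
  by rewrite -(size_map_poly (real_complex R)) lE size_prod_XsubC.
have sh : size h = (\sum_(a <- rootsR p) mup a p).+1.
  rewrite /h; elim: (rootsR p) => [|a s IH]; first by rewrite !big_nil size_poly1.
  rewrite !big_cons size_monicM ?monic_exp ?monicXsubC //; last first.
    by apply/monic_neq0/monic_prod => b _; rewrite monic_exp ?monicXsubC.
  by rewrite IH size_exp_XsubC addSn addnS.
exists l; split.
- by rewrite {1}pE size_monicM ?monic_neq0 // sh sg addSn addnS.
- case=> x y zl /=; apply/eqP => y0; rewrite {}y0 in zl.
  have gx : root g x.
    rewrite -(fmorph_root (real_complex R)) lE root_prod_XsubC; exact: zl.
  have px : x \in rootsR p.
    by rewrite -(roots_on_rootsR p0) in_itv /= pE rootM gx orbT.
  by have := gP x px; rewrite gx.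
by exists (map_poly (real_complex R) h); rewrite -lE mulrC -rmorphM -pE.
Qed.

(** Apply [nonreal_root_bound] to the roots in the upper half plane and to those
    in the lower half plane, and add the two inequalities. *)
Lemma bound_real_roots (R : rcfType) n p (A G : 'M[R]_n) (U : 'M[R]_(p, n)) :
  A *m G = G *m A^T -> U *m G *m U^T = 1%:M ->
  (2 * p <= n + \sum_(a <- rootsR (char_poly A)) mup a (char_poly A))%N.
Proof.
move=> AG UGU; have [l [sz lP [h cE]]] := real_factor_split (char_poly_monic A).
rewrite size_char_poly in sz; case: sz => sz.
rewrite map_char_poly in cE.
set up := fun z : R[i] => 0 < complex.Im z.
pose f1 := filter up l; pose f2 := filter (predC up) l.
have E1 : char_poly (map_mx (real_complex R) A)
    = \prod_(z <- f1) ('X - z%:P) * (\prod_(z <- f2) ('X - z%:P) * h).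
  by rewrite cE mulrA (bigID up) /= !big_filter.
have E2 := E1; rewrite mulrCA in E2.
have B1 : (p + size f1 <= n)%N.
  apply: (nonreal_root_bound AG UGU E1) => x y.
  rewrite !mem_filter => /andP [x0 _] /andP [y0 _].
  apply: contraTneq x0 => ->; case: y y0 => a b /= b0.
  by rewrite /up /= oppr_gt0 -leNgt ltW.
have B2 : (p + size f2 <= n)%N.
  apply: (nonreal_root_bound AG UGU E2) => x y.
  rewrite !mem_filter => /andP [x0 xl] /andP [y0 yl].
  apply: contraNneq x0 => ->; case: y y0 yl => a b /= b0 /lP /= b1.
  by rewrite /up /= oppr_gt0 lt_neqAle b1 leNgt.
have szl : (size f1 + size f2)%N = size l by rewrite !size_filter count_predC.
have := leq_add B1 B2; rewrite addnACA addnn -mul2n szl {2}sz.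
by rewrite addnA leq_add2r.
Qed.

(** * Bilinear and quadratic forms as matrices *)

Lemma eq_bilin_mx (R : pzRingType) m n (K L : 'M[R]_(m, n)) :
  (forall (x : 'rV_m) (y : 'rV_n), (x *m K *m y^T) 0 0 = (x *m L *m y^T) 0 0) -> K = L.
Proof.
move=> H; apply/matrixP => i j; have := H (delta_mx 0 i) (delta_mx 0 j).
by rewrite -!rowE trmx_delta -!colE !mxE.
Qed.

Lemma polarization_mx (R : realDomainType) n (K L : 'M[R]_n) :
  K^T = K -> L^T = L ->
  (forall x : 'rV_n, (x *m K *m x^T) 0 0 = (x *m L *m x^T) 0 0) -> K = L.
Proof.
have E (N : 'M[R]_n) : N^T = N -> forall x y : 'rV_n,
    ((x + y) *m N *m (x + y)^T) 0 0 = (x *m N *m x^T) 0 0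
      + (x *m N *m y^T) 0 0 *+ 2 + (y *m N *m y^T) 0 0.
  move=> Ns x y; have sw : y *m N *m x^T = x *m N *m y^T.
    rewrite [RHS]mx11_scalar -tr_scalar_mx -mx11_scalar !trmx_mul trmxK Ns.
    by rewrite mulmxA.
  rewrite linearD /= !mulmxDl !mulmxDr sw [LHS]mxE.
  by rewrite [X in X + _]mxE [X in _ + X]mxE mulr2n !addrA.
move=> Ks Ls H; apply: eq_bilin_mx => x y.
have := H (x + y); rewrite !E // !H => /addIr /addrI.
by move/eqP; rewrite eqr_pMn2r // => /eqP.
Qed.

(** * Self-adjoint endomorphisms *)

Theorem mainTheorem4 (R : realType) (r s n : nat) (hn : n = (r + 2 * s)%N)
    (Q : 'rV[R]_n -> R) (B : {symmetric 'rV[R]_n})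
    (hQB : forall X : 'rV[R]_n, Q X = B X X)
    (hQ : has_signature Q (r + s) s)
    (f : {linear 'rV[R]_n -> 'rV[R]_n})
    (hf : forall X Y : 'rV[R]_n, B (f X) Y = B X (f Y)) :
  (r <= num_real_eigenvalues f)%N.
Proof.
pose A := lin1_mx f; pose G := \matrix_(i, j) B (delta_mx 0 i) (delta_mx 0 j).
have BC X Y : B X Y = B Y X by rewrite hermC expr0 mul1r.
have BG X Y : B X Y = (X *m G *m Y^T) 0 0.
  rewrite {1}(row_sum_delta X) {1}(row_sum_delta Y) linear_sumlz.
  rewrite -mulmxA mxE; apply: eq_bigr => i _; rewrite linearZl_LR /=.
  rewrite linear_sumr mxE; congr (_ * _); apply: eq_bigr => j _.
  by rewrite linearZr_LR /= !mxE mulrC.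
have Gs : G^T = G by apply/matrixP => i j; rewrite !mxE BC.
have AG : A *m G = G *m A^T.
  apply: eq_bilin_mx => x y; rewrite !mulmxA -(mulmxA _ A^T) -trmx_mul.
  by rewrite -!BG !mul_rV_lin1 hf.
(* The first r + s vectors of the basis are orthonormal for B: this is the
   restriction of the normal form of Q to vectors with zero last s
   coordinates, polarized. *)
case: hQ => b _ bQ; pose U := \matrix_(i < r + s) tnth b (lshift s i).
have UGU : U *m G *m U^T = 1%:M.
  apply: polarization_mx; rewrite ?trmx1 ?trmx_mul ?trmxK ?Gs ?mulmxA //.
  move=> x; have := bQ (row_mx x 0); rewrite big_split_ord /= [X in _ + X]big1.
    rewrite addr0 /signature_mx mul_row_block !mulmx0 mul0mx mulmx1 !addr0.
    rewrite tr_row_mx mul_row_col trmx0 mulmx0 addr0 => <-.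
    have -> : \sum_(i < r + s) row_mx x 0 0 (lshift s i) *: tnth b (lshift s i)
        = x *m U.
      by rewrite mulmx_sum_row; apply: eq_bigr => i _; rewrite row_mxEl rowK.
    by rewrite hQB BG trmx_mul !mulmxA.
  by move=> i _; rewrite row_mxEr mxE scale0r.
have := bound_real_roots AG UGU; rewrite -/(num_real_eigenvalues f).
move: (num_real_eigenvalues f) => N; rewrite hn.
by rewrite mulnDr addnAC leq_add2r mul2n -addnn leq_add2l.
Qed.
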